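(* Let $Sp(K,S)$ be a split graph with $|K|=k\ge 2$ and biadjacency matrix $R$, so that \[A(Sp)=\begin{pmatrix} J-I & R\\ R^t & 0\end{pmatrix},\] and let $r=R^t\mathbf{1}$. Then \[\det(Sp)=(-1)^{k-1}\left((k-1)\det(R^tR)-r^t\operatorname{adj}(R^tR)\,r\right).\]
   Context: Graphs are finite and simple. A split graph is a graph $Sp$ whose vertex set is a disjoint union of a clique $K$ and an independent set $S$; the pair $(K,S)$ is called an s-partition, and $Sp(K,S)$ denotes $Sp$ together with this s-partition. Both $K$ and $S$ are assumed nonempty. The vertices are ordered as $(K,S)$; $J$ is an all-ones matrix, $I$ the identity, and $R$ is the $|K|\times|S|$ $0/1$ biadjacency matrix ($R_{uv}=1$ iff $u\in K$ and $v\in S$ are adjacent). $\mathbf{1}$ is the all-ones column vector, $\operatorname{adj}$ denotes the adjugate matrix, and $\det(Sp)$ means $\det(A(Sp))$. *)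

(* Defs.v *)
From HB Require Import structures.
From mathcomp Require Import all_boot all_order all_algebra.

Set Implicit Arguments.
Unset Strict Implicit.
Unset Printing Implicit Defensive.

Import GRing.Theory.
Local Open Scope ring_scope.

Definition simple_graph (V : finType) (e : rel V) : Prop :=
  symmetric e /\ irreflexive e.

Definition clique (V : finType) (e : rel V) (K : {set V}) : Prop :=
  {in K &, forall u v, u != v -> e u v}.

Definition independent (V : finType) (e : rel V) (S : {set V}) : Prop :=
  {in S &, forall u v, ~~ e u v}.

Record s_partition (V : finType) (e : rel V) (K S : {set V}) : Prop :=
  SPartition {
    sp_cover : K :|: S = [set: V];
    sp_disjoint : [disjoint K & S];
    sp_clique : clique e K;
    sp_independent : independent e S;
    sp_K_nonempty : K != set0;
    sp_S_nonempty : S != set0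
  }.

(* The ordering (K,S): the vertices of K come first, then those of S.
   When (K,S) is an s-partition, this is a bijection onto V. *)
Definition ks_vertex (V : finType) (K S : {set V}) (i : 'I_(#|K| + #|S|)) : V :=
  match split i with
  | inl a => enum_val a
  | inr b => enum_val b
  end.

Definition adjacency_mx (V : finType) (e : rel V) (n : nat)
    (vtx : 'I_n -> V) : 'M[int]_n :=
  \matrix_(i, j) (e (vtx i) (vtx j))%:R.

Definition split_adjacency_mx (V : finType) (e : rel V) (K S : {set V}) :
    'M[int]_(#|K| + #|S|) :=
  adjacency_mx e (@ks_vertex V K S).

Definition biadjacency_mx (V : finType) (e : rel V) (K S : {set V}) :
    'M[int]_(#|K|, #|S|) :=
  \matrix_(i, j) (e (enum_val i) (enum_val j))%:R.

(* Main.v *)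
(** Adjoining one extra row and column writes [J - I] as a Schur complement:
    the determinant of [(J - I, R; R^T, 0)] equals that of the matrix with
    blocks [(-I, R, 1; R^T, 0, 0; -1^T, 0, 1)].  Eliminating the block [-I]
    instead gives [(-1)^k] times the determinant of the bordered Gram matrix
    [(R^T R, r; -r^T, 1 - k)], which expands by the adjugate. *)
Require Import Defs.
From HB Require Import structures.
From mathcomp Require Import all_boot all_order all_algebra.

Set Implicit Arguments.
Unset Strict Implicit.
Unset Printing Implicit Defensive.

Import GRing.Theory.
Local Open Scope ring_scope.

Lemma det_castmx (R : comNzRingType) (m n : nat) (eq_mn : m = n) (A : 'M[R]_m) :
  \det (castmx (eq_mn, eq_mn) A) = \det A.
Proof. by case: n / eq_mn; rewrite castmx_id. Qed.

Lemma det_block_schur1 (R : comNzRingType) (m n : nat) (A : 'M[R]_m)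
    (B : 'M[R]_(m, n)) (C : 'M[R]_(n, m)) :
  \det (block_mx A B C 1%:M) = \det (A - B *m C).
Proof.
have -> : block_mx A B C 1%:M
  = block_mx 1%:M B 0 1%:M *m block_mx (A - B *m C) 0 C 1%:M.
  by rewrite mulmx_block !mul1mx !mul0mx !mulmx1 !add0r subrK.
by rewrite det_mulmx det_ublock det_lblock !det1 !mul1r mulr1.
Qed.

Lemma det_block_schurN1 (R : comNzRingType) (m n : nat) (B : 'M[R]_(m, n))
    (C : 'M[R]_(n, m)) (D : 'M[R]_n) :
  \det (block_mx (- 1%:M) B C D) = (-1) ^+ m * \det (D + C *m B).
Proof.
have -> : block_mx (- 1%:M) B C D
  = block_mx (- 1%:M) 0 C (D + C *m B) *m block_mx 1%:M (- B) 0 1%:M.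
  by rewrite mulmx_block !mulmx1 !mul0mx mulmx0 !addr0 mulNmx mul1mx opprK
             mulmxN addrC addrK.
by rewrite det_mulmx det_lblock det_ublock !det1 !mulr1 -scaleN1r detZ det1 mulr1.
Qed.

(** Right multiplication by [block_mx 1%:M (- (\adj G *m v)) 0 (\det G)%:M] clears the block [v],
    because [G *m \adj G] is the scalar matrix [\det G]. Both sides then carry an extra factor
    [\det G], which regularity cancels without inverting [G]. *)
Lemma det_block_border_reg (R : comNzRingType) (n : nat) (G : 'M[R]_n)
    (v : 'cV[R]_n) (u : 'rV[R]_n) (a : R) :
  GRing.rreg (\det G) ->
  \det (block_mx G v u a%:M) = a * \det G - (u *m \adj G *m v) 0 0.
Proof.
move=> regG; apply: regG.
have := det_mulmx (block_mx G v u a%:M)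
  (block_mx 1%:M (- (\adj G *m v)) 0 (\det G)%:M).
rewrite mulmx_block !mulmx1 !mulmx0 !addr0 mulmxN mulmxA mul_mx_adj.
rewrite mul_scalar_mx mul_mx_scalar addNr det_lblock det_ublock det1 mul1r.
rewrite det_scalar1 => <-; rewrite det_mx11 mulmxN mulmxA -scalar_mxM !mxE.
by rewrite mulr1n mulrC addrC.
Qed.

(* The characteristic matrix of [- G] specialises to [G] at 0, and its
   determinant is monic, hence regular. *)
Lemma det_block_border (R : comNzRingType) (n : nat) (G : 'M[R]_n)
    (v : 'cV[R]_n) (u : 'rV[R]_n) (a : R) :
  \det (block_mx G v u a%:M) = a * \det G - (u *m \adj G *m v) 0 0.
Proof.
pose ev : {rmorphism {poly R} -> R} := horner_eval (0 : R).
have evC p q (A : 'M[R]_(p, q)) : map_mx ev (map_mx polyC A) = A.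
  by apply/matrixP=> i j; rewrite !mxE /= /horner_eval hornerC.
have evG : map_mx ev (char_poly_mx (- G)) = G.
  by apply/matrixP=> i j; rewrite !mxE /= /horner_eval !hornerE hornerMn hornerX
                                  mul0rn sub0r opprK.
have regG : GRing.rreg (\det (char_poly_mx (- G))).
  exact/monic_rreg/char_poly_monic.
(* The regular case is applied over [{poly R}] to [X + G] with constant borders; evaluation at 0
   commutes with determinants and adjugates. *)
have := congr1 ev (det_block_border_reg (map_mx polyC v) (map_mx polyC u) a%:P regG).
rewrite rmorphB rmorphM -!det_map_mx map_block_mx !evC evG map_scalar_mx /=.
have -> : ev a%:P = a by rewrite /= /horner_eval hornerC.
move=> ->; congr (_ - _).
have -> (M : 'M[{poly R}]_1) : ev (M 0 0) = (map_mx ev M) 0 0 by rewrite mxE.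
by rewrite !map_mxM map_mx_adj !evC evG.
Qed.

Lemma det_split_block (F : comNzRingType) (k s : nat) (R : 'M[F]_(k, s)) :
  let r : 'cV[F]_s := R^T *m const_mx 1 in
  \det (block_mx (const_mx 1 - 1%:M) R R^T 0) =
    (-1) ^+ k * ((1 - k%:R) * \det (R^T *m R)
                 + (r^T *m \adj (R^T *m R) *m r) 0 0).
Proof.
move=> r; pose j : 'cV[F]_k := const_mx 1.
have jj : j *m j^T = const_mx 1.
  by apply/matrixP=> x y; rewrite !mxE big_ord1 !mxE mulr1.
have jTj : j^T *m j = k%:R%:M.
  apply/matrixP=> x y; rewrite !mxE !ord1 eqxx mulr1n.
  under eq_bigr do rewrite !mxE mulr1.
  by rewrite sumr_const card_ord.
(* Since J is [j *m j^T], the matrix is a rank-one update, put in the shape [A - B *m C]. *)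
have -> : block_mx (const_mx 1 - 1%:M) R R^T 0
  = block_mx (- 1%:M) R R^T 0 - col_mx j 0 *m row_mx (- j^T) 0.
  rewrite mul_col_row !mulmx0 !mul0mx mulmxN jj opp_block_mx add_block_mx.
  by rewrite !oppr0 !addr0 opprK addrC.
(* Regrouping the indices from [k + s + 1] to [k + (s + 1)] isolates [- 1%:M] as the leading
   block. *)
rewrite -det_block_schur1 -(det_castmx (esym (addnA k s 1))) -block_mxA.
rewrite det_block_schurN1 mul_col_row add_block_mx !add0r !mulNmx jTj.
have -> : (1%:M - k%:R%:M : 'M[F]_1) = (1 - k%:R)%:M by rewrite raddfB.
(* The lower border is [- r^T], so the adjugate term changes sign. *)
by rewrite det_block_border mulNmx !mulNmx mxE opprK /r trmx_mul trmxK.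
Qed.

Lemma split_adjacency_block (V : finType) (e : rel V) (K S : {set V}) :
  simple_graph e -> s_partition e K S ->
  let R := biadjacency_mx e K S in
  split_adjacency_mx e K S = block_mx (const_mx 1 - 1%:M) R R^T 0.
Proof.
move=> [symE irrE] [_ _ cliqueK indepS _ _] R.
(* Block indices are images under [unsplit], so [unsplitK] evaluates [ks_vertex] on each block. *)
rewrite -[LHS]submxK; congr block_mx; apply/matrixP=> x y;
  rewrite !mxE /ks_vertex ?(unsplitK (inl _)) ?(unsplitK (inr _)).
- have [->|neq_xy] := eqVneq x y; first by rewrite irrE subrr.
  by rewrite cliqueK ?enum_valP ?(inj_eq enum_val_inj) // subr0.
- by [].
- by rewrite symE.
- by rewrite (negPf (indepS _ _ (enum_valP x) (enum_valP y))).
Qed.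

Theorem theorem8p3 (V : finType) (e : rel V) (K S : {set V})
    (he : simple_graph e) (hKS : s_partition e K S) (hK : (2 <= #|K|)%N) :
  let R := biadjacency_mx e K S in
  let r : 'cV[int]_(#|S|) := R^T *m const_mx 1 in
  split_adjacency_mx e K S = block_mx (const_mx 1 - 1%:M) R R^T 0 /\
  \det (split_adjacency_mx e K S) =
    (-1) ^+ (#|K| - 1) *
      ((#|K|%:R - 1) * \det (R^T *m R)
       - (r^T *m \adj (R^T *m R) *m r) 0 0).
Proof.
move=> R r; have eqA := split_adjacency_block he hKS; split=> //.
(* As [#|K|] is positive, [#|K| - 1] is not truncated; the sign split off here turns [1 - k] into
   [k - 1]. *)
have signK : (-1) ^+ #|K| = - (-1) ^+ (#|K| - 1) :> int.
  by rewrite -{1}(subnK (ltnW hK)) addn1 exprS mulN1r.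
by rewrite eqA det_split_block signK mulNr -mulrN opprD -mulNr opprB.
Qed.
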